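(* Let $c>1$, $M>0$, and $r(x):=\max\{c|x|,M\}$ for $x\in\mathbb{R}^2$. Then, for all sufficiently small $\alpha>0$ (that is, there exists $\alpha_0>0$ such that for every $\alpha\in(0,\alpha_0]$), the function $r^{-\alpha}\colon x\mapsto r(x)^{-\alpha}$ on $\mathbb{R}^2$ is $(\sigma,r)$-supermedian and $(\lambda,r)$-supermedian.
   Context: $\mathbb{R}^2$ is identified with $\mathbb{C}$, and $|\cdot|$ is the Euclidean norm. For $x\in\mathbb{R}^2$, $\rho>0$ and a function $f$ on $\mathbb{R}^2$, $\sigma_{x,\rho}(f):=\frac1{2\pi}\int_0^{2\pi}f(x+\rho e^{it})\,dt$ is the average of $f$ on the circle of center $x$ and radius $\rho$, and $\lambda_{x,\rho}(f):=\frac{1}{\pi\rho^2}\int_{B(x,\rho)}f(y)\,dy$ is the average of $f$ (with respect to Lebesgue measure) on the closed disk $B(x,\rho)=\{y\in\mathbb{R}^2: |y-x|\le\rho\}$. Given $r\colon\mathbb{R}^2\to(0,\infty)$, a function $f$ is called $(\sigma,r)$-supermedian if $\sigma_{x,r(x)}(f)\le f(x)$ for every $x\in\mathbb{R}^2$, and $(\lambda,r)$-supermedian if $\lambda_{x,r(x)}(f)\le f(x)$ for every $x\in\mathbb{R}^2$. *)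

(* Defs.v *)
From HB Require Import structures.
From mathcomp Require Import all_boot all_order all_algebra.
From mathcomp Require Import all_classical all_reals all_analysis.
Set Implicit Arguments.
Unset Strict Implicit.
Unset Printing Implicit Defensive.
Import Order.TTheory GRing.Theory Num.Theory.
Import numFieldNormedType.Exports.
Local Open Scope classical_set_scope.
Local Open Scope ring_scope.

(* The canonical norm on [R * R] is the sup norm, hence an explicit one. *)
Definition enorm (R : realType) (x : R * R) : R :=
  Num.sqrt (x.1 ^+ 2 + x.2 ^+ 2).

Definition edisk (R : realType) (x : R * R) (rho : R) : set (R * R) :=
  [set y | enorm (y - x) <= rho].

(* x + rho e^{it} *)
Definition circle_pt (R : realType) (x : R * R) (rho t : R) : R * R :=
  (x.1 + rho * cos t, x.2 + rho * sin t).

(* The averages are extended-real valued, so that an infinite integral is not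
   silently replaced by 0, as it would be with [Rintegral]. *)
Definition circle_avg (R : realType) (x : R * R) (rho : R) (f : R * R -> R) :
    \bar R :=
  ((2 * pi)^-1%:E *
   \int[@lebesgue_measure R]_(t in `[0%R, (2 * pi)%R])
     (f (circle_pt x rho t))%:E)%E.

Definition disk_avg (R : realType) (x : R * R) (rho : R) (f : R * R -> R) :
    \bar R :=
  ((pi * rho ^+ 2)^-1%:E *
   \int[(@lebesgue_measure R \x @lebesgue_measure R)%E]_(y in edisk x rho) (f y)%:E)%E.

Definition sigma_supermedian (R : realType) (r f : R * R -> R) : Prop :=
  forall x, (circle_avg x (r x) f <= (f x)%:E)%E.

Definition lambda_supermedian (R : realType) (r f : R * R -> R) : Prop :=
  forall x, (disk_avg x (r x) f <= (f x)%:E)%E.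

(* Main.v *)
Require Import Defs.
From mathcomp Require Import all_boot all_order all_algebra.
From mathcomp Require Import all_classical all_reals all_analysis.
From mathcomp Require Import measurable_realfun.
From mathcomp Require Import ring lra.
Import Order.TTheory GRing.Theory Num.Theory.
Import numFieldNormedType.Exports.
Local Open Scope classical_set_scope.
Local Open Scope ring_scope.

(** Write [X] for [|x|], [v = |x + y| / X] and [s = |y| / X].  If [c X <= M],
    the value [r x `^ (- alpha) = M `^ (- alpha)] is the maximum of the
    function and there is nothing to do.  Otherwise [r x = c X], and
    [r (x + y) `^ (- alpha) <= r x `^ (- alpha) * v `^ (- alpha)], so one has to
    show that suitable averages of [v `^ (- alpha)] are at most 1.  To first
    order in [alpha] this is [1 - alpha * ln v], and the average of [ln v] over
    the circle of radius [s X] is [ln s] for [s > 1] and 0 for [s < 1]: it is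
    positive on the circle of radius [c X], and also on the disk.

    The mean value of the logarithm is replaced by a finite product.  Averaging
    over [N = 2 ^ n] rotations of [y] by multiples of [2 pi / N] turns the
    product of the [v] into [|x^N + w| / X^N] in complex notation, where [w] is
    [y^N] up to sign, so that the product is at least [|1 - s^N|]
    ([prod_enorm_rotc]); hence, as soon as the [v] stay in
    [[expR (- B), expR B]], the sum of the [v `^ (- alpha)] over the rotations
    is at most [N (1 + (alpha B)^2) - alpha ln |1 - s^N|]
    ([sum_powRN_rotc_le]).  For [s >= q > 1] the last logarithm is about
    [N ln q], for [s < 1] it is about 0.

    For the circle this is enough, with [s = c] and any [N] such that
    [c^N >= 3]: the integral of a periodic function does not change under
    shifts.  For the disk one uses that planar Lebesgue measure is invariant
    under rotations (a rotation is a product of three shears, and shears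
    preserve the measure by Tonelli's theorem), and cuts the disk into four
    parts:
    - [s <= 1 - d] and [1 + d < s <= c'], with [c' = (1 + c) / 2], where the
      averages of [v `^ (- alpha)] exceed 1 by at most a small multiple of
      [alpha];
    - [c' < s <= c], where they are below 1 by about [alpha ln c'];
    - the thin annulus [1 - d < s <= 1 + d] around the singularity, where there
      is no averaging and the excess is [alpha] times an integral that is small
      with [d] ([integral_annulus_powRN_singular_le]).
    The gain on the outer annulus pays for the three losses
    ([annuli_budget]) once [d], then [N], then [alpha] are small, large and
    small enough. *)

Set Implicit Arguments.
Unset Strict Implicit.
Unset Printing Implicit Defensive.

(** * The Euclidean plane and its rotations *)

Lemma enorm_ge0 (R : realType) (x : R * R) : 0 <= enorm x.
Proof. exact: sqrtr_ge0. Qed.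

Lemma sqr_enorm (R : realType) (x : R * R) :
  enorm x ^+ 2 = x.1 ^+ 2 + x.2 ^+ 2.
Proof. by rewrite sqr_sqrtr// addr_ge0// sqr_ge0. Qed.

Lemma enorm_eq (R : realType) (x : R * R) (a : R) :
  0 <= a -> x.1 ^+ 2 + x.2 ^+ 2 = a ^+ 2 -> enorm x = a.
Proof. by move=> a0 e; rewrite /enorm e sqrtr_sqr ger0_norm. Qed.

Lemma enormN (R : realType) (x : R * R) : enorm (- x) = enorm x.
Proof. by apply: enorm_eq; rewrite ?enorm_ge0// sqr_enorm /=; ring. Qed.

Lemma ler_normf_enorm (R : realType) (x : R * R) : `|x.1| <= enorm x.
Proof. by rewrite -sqrtr_sqr ler_wsqrtr// lerDl sqr_ge0. Qed.

Lemma ler_norms_enorm (R : realType) (x : R * R) : `|x.2| <= enorm x.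
Proof. by rewrite -sqrtr_sqr ler_wsqrtr// lerDr sqr_ge0. Qed.

Lemma ler_enormD (R : realType) (x y : R * R) :
  enorm (x + y) <= enorm x + enorm y.
Proof.
rewrite -ler_sqr ?nnegrE ?addr_ge0 ?enorm_ge0// sqrrD !sqr_enorm /=.
suff : x.1 * y.1 + x.2 * y.2 <= enorm x * enorm y by lra.
rewrite (le_trans (ler_norm _))//.
rewrite -ler_sqr ?nnegrE ?mulr_ge0 ?enorm_ge0// real_normK ?num_real//.
rewrite exprMn !sqr_enorm.
have := sqr_ge0 (x.1 * y.2 - x.2 * y.1); nra.
Qed.

Lemma ler_dist_enorm (R : realType) (x y : R * R) :
  `|enorm x - enorm y| <= enorm (x + y).
Proof.
rewrite ler_norml; apply/andP; split.
  have := ler_enormD (x + y) (- x); rewrite enormN addrAC subrr add0r; lra.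
have := ler_enormD (x + y) (- y); rewrite enormN addrK; lra.
Qed.

(** Multiplication by [e^{it}] in the complex plane. *)
Definition rotc (R : realType) (t : R) (y : R * R) : R * R :=
  (cos t * y.1 - sin t * y.2, sin t * y.1 + cos t * y.2).

Lemma enorm_rotc (R : realType) (t : R) (y : R * R) : enorm (rotc t y) = enorm y.
Proof.
apply: enorm_eq; rewrite ?enorm_ge0// sqr_enorm /=.
have := cos2Dsin2 t; set c := cos t; set s := sin t => e.
have -> : (c * y.1 - s * y.2) ^+ 2 + (s * y.1 + c * y.2) ^+ 2
  = (c ^+ 2 + s ^+ 2) * (y.1 ^+ 2 + y.2 ^+ 2) by ring.
by rewrite e mul1r.
Qed.

Lemma rotc0 (R : realType) (y : R * R) : rotc 0 y = y.
Proof. by case: y => a b; rewrite /rotc cos0 sin0 /= !mul1r !mul0r subr0 add0r. Qed.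

Lemma rotcD (R : realType) (s t : R) (y : R * R) :
  rotc (s + t) y = rotc s (rotc t y).
Proof. by rewrite /rotc cosD sinD /=; congr pair; ring. Qed.

Lemma rotcDpi (R : realType) (t : R) (y : R * R) : rotc (t + pi) y = - rotc t y.
Proof.
rewrite /rotc cosDpi sinDpi; apply/eqP; rewrite xpair_eqE /=.
by apply/andP; split; apply/eqP; ring.
Qed.

(** The square in the complex plane. *)
Definition csq (R : realType) (y : R * R) : R * R :=
  (y.1 ^+ 2 - y.2 ^+ 2, 2 * y.1 * y.2).

Lemma enorm_csq (R : realType) (y : R * R) : enorm (csq y) = enorm y ^+ 2.
Proof. by apply: enorm_eq; rewrite ?sqr_ge0// sqr_enorm /=; ring. Qed.

Lemma enorm_csqB (R : realType) (x y : R * R) :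
  enorm (csq x - csq y) = enorm (x + y) * enorm (x - y).
Proof.
apply: enorm_eq; rewrite ?mulr_ge0 ?enorm_ge0// exprMn !sqr_enorm /=; ring.
Qed.

Lemma rotc_csq (R : realType) (t : R) (y : R * R) :
  rotc (2 * t) (- csq y) = - csq (rotc t y).
Proof.
rewrite mulr_natl mulr2n /rotc cosD sinD; apply/eqP; rewrite xpair_eqE /=.
by apply/andP; split; apply/eqP; ring.
Qed.

(** In complex notation the product of [x + w y] over the [N]-th roots of unity
    [w] is [x^N] plus or minus [y^N].  For [N = 2 ^ n] this follows by induction:
    opposite rotations pair up as [(x + w)(x - w) = x^2 - w^2], which leaves
    the case of [N / 2] rotations for [x^2] and [- y^2].  The angle [h] is a
    parameter because the induction doubles it. *)
Lemma prod_enorm_rotc (R : realType) (n : nat) (h : R) (x y : R * R) :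
  2 ^+ n * h = 2 * pi ->
  `|enorm x ^+ (2 ^ n) - enorm y ^+ (2 ^ n)|
    <= \prod_(0 <= k < 2 ^ n) enorm (x + rotc (k%:R * h) y).
Proof.
elim: n h x y => [|n IH] h x y hE.
  by rewrite expn0 !expr1 big_nat1 mul0r rotc0 ler_dist_enorm.
have hE' : 2 ^+ n * (2 * h) = 2 * pi by rewrite mulrA -exprSr.
have hpi : (2 ^ n)%:R * h = pi.
  apply: (@mulfI R 2); rewrite ?pnatr_eq0//.
  by rewrite natrX mulrA -exprS.
have := IH _ (csq x) (- csq y) hE'.
rewrite enormN !enorm_csq -!exprM -!expnS => /le_trans; apply.
have -> : (2 ^ n.+1 = 2 ^ n + 2 ^ n)%N by rewrite expnS mul2n addnn.
rewrite [leRHS](@big_cat_nat _ _ _ (2 ^ n)%N) ?leq_addr//=.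
have -> : \prod_(2 ^ n <= k < 2 ^ n + 2 ^ n) enorm (x + rotc (k%:R * h) y) =
    \prod_(0 <= k < 2 ^ n) enorm (x + rotc ((k + 2 ^ n)%:R * h) y).
  by rewrite -{1}(add0n (2 ^ n)%N) big_addn addnK.
rewrite -big_split /=.
rewrite le_eqVlt; apply/orP; left; apply/eqP; apply: eq_bigr => k _.
by rewrite mulrCA rotc_csq enorm_csqB natrD mulrDl hpi rotcDpi.
Qed.

Lemma circle_ptE (R : realType) (x : R * R) (rho t : R) :
  circle_pt x rho t = x + rotc t (rho, 0).
Proof.
by rewrite /circle_pt /rotc /= !mulr0 subr0 addr0 ![rho * _]mulrC; case: x.
Qed.

(** * From products to sums of negative powers *)

(** From [expR (- u) >= 1 - u] at [u = w / 2], squared; [3^-1] is a convenient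
    value below the root of [1 - 3 * w + w ^+ 2]. *)
Lemma expR_le_quadratic (R : realType) (w : R) :
  w <= 3^-1 -> expR w <= 1 + w + w ^+ 2.
Proof.
move=> w3; set e := expR (w / 2).
have e0 : 0 < e by exact: expR_gt0.
have -> : expR w = e ^+ 2 by rewrite expr2 -expRD -splitr.
have he : e * (1 - w / 2) <= 1.
  rewrite -[leRHS](expRxMexpNx_1 (w / 2)) ler_pM2l//.
  exact: expR_ge1Dx.
have d0 : 0 < 1 - w / 2 by lra.
have : (e * (1 - w / 2)) ^+ 2 <= 1.
  by rewrite -[leRHS](expr1n _ 2) lerXn2r ?nnegrE ?mulr_ge0 ?(ltW d0) ?(ltW e0).
rewrite exprMn -ler_pdivlMr ?exprn_gt0// div1r => /le_trans; apply.
rewrite -div1r ler_pdivrMr ?exprn_gt0//.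
have q0 : 0 <= 1 - 3 * w + w ^+ 2 by nra.
have -> : (1 + w + w ^+ 2) * (1 - w / 2) ^+ 2 =
  1 + w ^+ 2 * (1 - 3 * w + w ^+ 2) / 4 by field.
by rewrite lerDl divr_ge0// mulr_ge0// sqr_ge0.
Qed.

Lemma powRE_gt0 (R : realType) (a x : R) : 0 < a -> a `^ x = expR (x * ln a).
Proof. by move=> a0; rewrite /powR gt_eqF. Qed.

(** Second order expansion of [v `^ (- alpha) = expR (- alpha * ln v)], whose
    first order terms add up to the logarithm of the product. *)
Lemma sum_powRN_le (R : realType) (N : nat) (v : nat -> R) (alpha B : R) :
  (forall k, expR (- B) <= v k <= expR B) -> 0 <= alpha -> alpha * B <= 3^-1 ->
  \sum_(0 <= k < N) v k `^ (- alpha) <=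
    N%:R * (1 + (alpha * B) ^+ 2) - alpha * ln (\prod_(0 <= k < N) v k).
Proof.
move=> vB a0 aB.
have v0 k : 0 < v k by case/andP: (vB k) => + _; apply: lt_le_trans; exact: expR_gt0.
have -> : \prod_(0 <= k < N) v k = expR (\sum_(0 <= k < N) ln (v k)).
  by rewrite expR_sum; apply: eq_bigr => k _; rewrite lnK ?posrE.
rewrite expRK mulr_sumr.
have -> : N%:R * (1 + (alpha * B) ^+ 2) =
   \sum_(0 <= k < N) (1 + (alpha * B) ^+ 2).
  by rewrite sumr_const_nat subn0 mulr_natl.
rewrite -sumrB; apply: ler_sum => k _.
have lB : `|ln (v k)| <= B.
  have /andP[h1 h2] := vB k.
  rewrite ler_norml; apply/andP; split.
    by rewrite -(expRK (- B)) ler_ln ?posrE ?expR_gt0.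
  by rewrite -(expRK B) ler_ln ?posrE ?expR_gt0.
have aLB : `|alpha * ln (v k)| <= alpha * B.
  by rewrite normrM ger0_norm// ler_wpM2l.
rewrite powRE_gt0// mulNr (le_trans (expR_le_quadratic _))//.
  by move: aLB; rewrite ler_norml => /andP[? ?]; lra.
rewrite sqrrN.
have : (alpha * ln (v k)) ^+ 2 <= (alpha * B) ^+ 2.
  by rewrite -real_normK ?num_real// lerXn2r ?nnegrE// (le_trans _ aLB).
lra.
Qed.

(** The mean value property of the logarithm, with [1 - s ^+ (2 ^ n)] in the
    place of the exact value.  The bounds on [s] keep every rotated point at a
    distance from the origin comparable to [enorm x]. *)
Lemma sum_powRN_rotc_le (R : realType) (n : nat) (h : R) (x y : R * R)
    (s alpha B : R) :
  2 ^+ n * h = 2 * pi -> 0 < enorm x -> enorm y = s * enorm x ->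
  expR (- B) <= `|1 - s| -> 1 + s <= expR B ->
  0 <= alpha -> alpha * B <= 3^-1 ->
  \sum_(0 <= k < 2 ^ n)
      (enorm (x + rotc (k%:R * h) y) / enorm x) `^ (- alpha) <=
    2 ^+ n * (1 + (alpha * B) ^+ 2) - alpha * ln `|1 - s ^+ (2 ^ n)|.
Proof.
move=> hE x0 ys sB1 sB2 a0 aB.
have s0 : 0 <= s by rewrite -(pmulr_lge0 _ x0) -ys enorm_ge0.
have s1 : s != 1.
  apply/eqP => s1; move: sB1; rewrite s1 subrr normr0.
  by rewrite leNgt expR_gt0.
apply: (le_trans (sum_powRN_le _ _ a0 aB)).
  move=> k; apply/andP; split.
    apply: (le_trans sB1); rewrite ler_pdivlMr//.
    have := ler_dist_enorm x (rotc (k%:R * h) y); rewrite enorm_rotc ys.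
    by rewrite -{1}(mul1r (enorm x)) -mulrBl normrM (ger0_norm (enorm_ge0 x)).
  rewrite ler_pdivrMr// (le_trans (ler_enormD _ _))// enorm_rotc ys.
  by rewrite -{1}(mul1r (enorm x)) -mulrDl ler_wpM2r// ltW.
rewrite natrX lerD2l lerN2 ler_wpM2l//.
have sN : 0 < `|1 - s ^+ (2 ^ n)|.
  by rewrite normr_gt0 subr_eq0 eq_sym pexpr_eq1 ?expn_gt0.
suff hp : `|1 - s ^+ (2 ^ n)| <=
    \prod_(0 <= k < 2 ^ n) (enorm (x + rotc (k%:R * h) y) / enorm x).
  by rewrite ler_ln// posrE// (lt_le_trans sN).
rewrite prodf_div prodr_const_nat subn0 ler_pdivlMr ?exprn_gt0//.
apply: le_trans (prod_enorm_rotc x y hE).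
rewrite ys exprMn -{2}(mul1r (enorm x ^+ _)) -mulrBl normrM.
by rewrite [X in _ <= _ * X]ger0_norm// exprn_ge0// ltW.
Qed.

(** * Invariance of planar Lebesgue measure *)

Local Notation lebesgue2 R := (@lebesgue_measure R \x @lebesgue_measure R)%E.

Lemma ge0_integral_translate (R : realType) (t : R) (f : R -> \bar R) :
  measurable_fun setT f -> (forall a, 0 <= f a)%E ->
  (\int[@lebesgue_measure R]_a f (a + t)%R = \int[@lebesgue_measure R]_a f a)%E.
Proof.
move=> mf f0.
pose phi := (fun a => a + t) : measurableTypeR R -> measurableTypeR R.
have mt : measurable_fun setT phi by exact: measurable_funD.
rewrite -[LHS](@ge0_integral_pushforward _ _ _ _ _ phi mt
  (@lebesgue_measure R) setT f)//.
apply: eq_measure_integral => /= A mA _.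
apply/esym/lebesgue_measure_unique => //= _ [[a b]] _ <-.
rewrite /pushforward.
have -> : phi @^-1` `]a, b]%classic = `]a - t, b - t]%classic.
  by apply/seteqP; split => x /=; rewrite !in_itv/= /phi ltrBlDr lerBrDr.
rewrite !lebesgue_measure_itv/= !lte_fin ltrD2r.
by case: ifPn => //; rewrite -!EFinB => _; congr EFin; ring.
Qed.

Lemma ge0_integral_shear1 (R : realType) (phi : R -> R) (F : R * R -> \bar R) :
  measurable_fun setT phi -> measurable_fun setT F -> (forall z, 0 <= F z)%E ->
  (\int[lebesgue2 R]_z F (z.1 + phi z.2, z.2)%R = \int[lebesgue2 R]_z F z)%E.
Proof.
move=> mphi mF F0.
have mG : measurable_fun setT (fun z : R * R => F (z.1 + phi z.2, z.2)).
  apply: measurableT_comp => //; apply/measurable_fun_pairP; split => /=.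
    apply: measurable_funD; first exact: measurable_fst.
    apply: measurableT_comp => //; exact: measurable_snd.
  exact: measurable_snd.
rewrite [RHS](@fubini_tonelli2 _ _ (measurableTypeR R) (measurableTypeR R) _ _ _ F mF F0).
rewrite [LHS](@fubini_tonelli2 _ _ (measurableTypeR R) (measurableTypeR R) _ _ _ _ mG)//.
apply: eq_integral => b _; rewrite /fubini_G /=.
apply: (ge0_integral_translate (phi b) (f := fun a => F (a, b))) => //.
exact: measurableT_comp.
Qed.

Lemma ge0_integral_shear2 (R : realType) (phi : R -> R) (F : R * R -> \bar R) :
  measurable_fun setT phi -> measurable_fun setT F -> (forall z, 0 <= F z)%E ->
  (\int[lebesgue2 R]_z F (z.1, z.2 + phi z.1)%R = \int[lebesgue2 R]_z F z)%E.
Proof.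
move=> mphi mF F0.
have mG : measurable_fun setT (fun z : R * R => F (z.1, z.2 + phi z.1)).
  apply: measurableT_comp => //; apply/measurable_fun_pairP; split => /=.
    exact: measurable_fst.
  apply: measurable_funD; first exact: measurable_snd.
  apply: measurableT_comp => //; exact: measurable_fst.
rewrite [RHS](@fubini_tonelli1 _ _ (measurableTypeR R) (measurableTypeR R) _ _ _ F mF F0).
rewrite [LHS](@fubini_tonelli1 _ _ (measurableTypeR R) (measurableTypeR R) _ _ _ _ mG)//.
apply: eq_integral => a _; rewrite /fubini_F /=.
apply: (ge0_integral_translate (phi a) (f := fun b => F (a, b))) => //.
exact: measurableT_comp.
Qed.

Lemma measurable_fun_addl (R : realType) (x : R * R) :
  measurable_fun setT (fun z : R * R => x + z).
Proof.
by apply/measurable_fun_pairP; split; apply: measurable_funD.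
Qed.

Lemma measurable_rotc (R : realType) (t : R) : measurable_fun setT (@rotc R t).
Proof.
have m1 := @measurable_fst _ _ (measurableTypeR R) (measurableTypeR R).
have m2 := @measurable_snd _ _ (measurableTypeR R) (measurableTypeR R).
apply/measurable_fun_pairP; split.
  by apply: measurable_funB; apply: measurable_funM.
by apply: measurable_funD; apply: measurable_funM.
Qed.

Lemma measurable_enorm (R : realType) : measurable_fun setT (@enorm R).
Proof.
have m1 := @measurable_fst _ _ (measurableTypeR R) (measurableTypeR R).
have m2 := @measurable_snd _ _ (measurableTypeR R) (measurableTypeR R).
apply: (@measurableT_comp _ _ _ _ _ _ (@Num.sqrt R)).
  exact: (continuous_measurable_fun (@sqrt_continuous R)).
by apply: measurable_funD; apply: measurable_funX.
Qed.

Lemma ge0_integral_addl (R : realType) (x : R * R) (F : R * R -> \bar R) :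
  measurable_fun setT F -> (forall z, 0 <= F z)%E ->
  (\int[lebesgue2 R]_z F (x + z)%R = \int[lebesgue2 R]_z F z)%E.
Proof.
move=> mF F0.
rewrite -[RHS](ge0_integral_shear1 (phi := fun=> x.1))//.
rewrite -[RHS](ge0_integral_shear2 (phi := fun=> x.2))//.
  by apply: eq_integral => -[a b] _; rewrite addrC; case: x.
apply: measurableT_comp => //.
apply/measurable_fun_pairP; split => /=; last exact: measurable_snd.
by apply: measurable_funD; first exact: measurable_fst.
Qed.

(** For [cos t != -1] the rotation is a shear along the first axis of slope
    [- tan (t / 2)], followed by one along the second axis of slope [sin t] and
    by the first one again.  The rotation by [pi] has no such decomposition,
    but is the square of the rotation by [pi / 2]. *)
Lemma ge0_integral_rotc (R : realType) (t : R) (F : R * R -> \bar R) :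
  measurable_fun setT F -> (forall z, 0 <= F z)%E ->
  (\int[lebesgue2 R]_z F (rotc t z) = \int[lebesgue2 R]_z F z)%E.
Proof.
have main (u : R) (G : R * R -> \bar R) : cos u != -1 ->
    measurable_fun setT G -> (forall z, 0 <= G z)%E ->
    (\int[lebesgue2 R]_z G (rotc u z) = \int[lebesgue2 R]_z G z)%E.
  move=> cu mG G0.
  have m1 := @measurable_fst _ _ (measurableTypeR R) (measurableTypeR R).
  have m2 := @measurable_snd _ _ (measurableTypeR R) (measurableTypeR R).
  pose k := - (sin u / (1 + cos u)).
  have mk (a : R) : measurable_fun setT (fun b : R => a * b).
    exact: measurable_funM.
  rewrite -[RHS](ge0_integral_shear1 (phi := fun b => k * b))//.
  rewrite -[RHS](ge0_integral_shear2 (phi := fun b => sin u * b))//; last first.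
    apply: measurableT_comp => //.
    apply/measurable_fun_pairP; split => //=.
    by apply: measurable_funD => //; exact: measurable_funM.
  rewrite -[RHS](ge0_integral_shear1 (phi := fun b => k * b))//; last first.
    apply: measurableT_comp => //.
    have ms : measurable_fun [set: R * R] (fun z : R * R => z.2 + sin u * z.1).
      by apply: measurable_funD => //; exact: measurable_funM.
    apply/measurable_fun_pairP; split => //=.
    by apply: measurable_funD => //; exact: measurable_funM.
  apply: eq_integral => -[a b] _; congr G.
  have cu0 : 1 + cos u != 0 by rewrite addrC -[1]opprK subr_eq0.
  have sk : sin u * k = cos u - 1.
    by rewrite /k mulrN mulrA -expr2 sin2cos2; field.
  have ck : k * cos u = - sin u - k by rewrite /k; field.
  rewrite /rotc /=; congr pair.
    have -> : a + k * b + k * (b + sin u * (a + k * b)) =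
      a + k * b + k * b + (sin u * k) * a + k * (sin u * k) * b by ring.
    by rewrite sk mulrBr ck; ring.
  have -> : b + sin u * (a + k * b) = b + sin u * a + (sin u * k) * b by ring.
  by rewrite sk; ring.
move=> mF F0.
have [ct|ct] := eqVneq (cos t) (-1); last exact: main.
have ct2 : cos (t / 2) != -1.
  apply/eqP => h; have := cosD (t / 2) (t / 2).
  rewrite -splitr ct -!expr2 sin2cos2 h; lra.
rewrite -(main (t / 2) F)// -(main (t / 2) (fun z => F (rotc (t / 2) z)))//.
  by apply: eq_integral => z _; rewrite -rotcD -splitr.
by apply: measurableT_comp => //; exact: measurable_rotc.
Qed.

(** * Integrals over annuli *)

(** Radii range over an interval so that disks and annuli are treated
    alike, disks being the case of an interval unbounded below. *)
Definition annulus (R : realType) (x : R * R) (i : interval R) : set (R * R) :=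
  [set z | enorm (z - x) \in i].

Lemma measurable_annulus (R : realType) (x : R * R) (i : interval R) :
  measurable (annulus x i).
Proof.
have m : measurable_fun setT (fun z : R * R => enorm (- x + z)).
  by apply: measurableT_comp; [exact: measurable_enorm|exact: measurable_fun_addl].
have := m measurableT _ (measurable_itv i); rewrite setTI.
by congr measurable; apply/seteqP; split => z /=; rewrite addrC.
Qed.

(** Averaging principle: if finitely many functions have the same integral [I]
    and their mean is at most [K] pointwise, then [I] is bounded by the
    integral of [K].  It is used for the shifts of a periodic function and for
    the rotations of a function on an annulus. *)
Lemma ge0_integral_mean_le d (T : measurableType d) (R : realType)
    (mu : {measure set T -> \bar R}) (D : set T) (N : nat)
    (G : nat -> T -> R) (I : \bar R) (K : R) :
  measurable D -> (0 < N)%N -> (forall k, measurable_fun setT (G k)) ->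
  (forall k z, 0 <= G k z) ->
  (forall k, (k < N)%N -> \int[mu]_(z in D) (G k z)%:E = I)%E ->
  (forall z, D z -> \sum_(0 <= k < N) G k z <= N%:R * K) ->
  (I <= K%:E * mu D)%E.
Proof.
move=> mD N0 mG G0 GI hK.
have mGE k : measurable_fun D (fun z => (G k z)%:E).
  by apply/measurable_EFinP; exact: measurable_funTS.
have Npos : (0 < N%:R%:E :> \bar R)%E by rewrite lte_fin ltr0n.
rewrite -(@lee_pmul2l _ N%:R%:E)// muleA -EFinM.
have -> : (N%:R%:E * I = \int[mu]_(z in D)
    \sum_(k <- index_iota 0 N) (G k z)%:E)%E.
  rewrite ge0_integral_sum//; last by move=> k z _; rewrite lee_fin.
  rewrite (eq_big_nat _ _ (F2 := fun=> I)); last by move=> k /andP[_ /GI].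
  by rewrite mule_natl big_const_nat subn0 -Monoid.iteropE.
rewrite -integral_cst//; apply: ge0_le_integral => //.
- by move=> z _; apply: sume_ge0 => k _; rewrite lee_fin.
- exact: emeasurable_sum.
- by move=> z Dz; rewrite sumEFin lee_fin hK.
Qed.

Lemma ge0_integral_annulus_rotc (R : realType) (t : R) (x : R * R)
    (i : interval R) (F : R * R -> R) :
  measurable_fun setT F -> (forall z, 0 <= F z) ->
  (\int[lebesgue2 R]_(y in annulus (0%R : R * R) i) (F (x + rotc t y)%R)%:E =
   \int[lebesgue2 R]_(z in annulus x i) (F z)%:E)%E.
Proof.
move=> mF F0; pose G := (EFin \o F) \_ (annulus x i).
have G0 z : (0 <= G z)%E by apply: erestrict_ge0 => ? _ /=; rewrite lee_fin.
have mG : measurable_fun setT G.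
  apply/(measurable_restrictT _ (measurable_annulus x i)).
  by apply/measurable_EFinP; exact: measurable_funTS.
rewrite integral_mkcond [RHS]integral_mkcond -/G.
transitivity (\int[lebesgue2 R]_y G (x + rotc t y)%R)%E; last first.
  transitivity (\int[lebesgue2 R]_y G (x + y)%R)%E.
    apply: (ge0_integral_rotc t (F := fun y => G (x + y))) => //.
    by apply: measurableT_comp => //; exact: measurable_fun_addl.
  exact: ge0_integral_addl.
apply: eq_integral => y _; rewrite /G !patchE.
congr (if _ then _ else _); apply/idP/idP.
  by rewrite !in_setE /annulus /= subr0 addrAC subrr add0r enorm_rotc.
by rewrite !in_setE /annulus /= subr0 addrAC subrr add0r enorm_rotc.
Qed.

Lemma integral_annulus_le (R : realType) (N : nat) (h : R) (x : R * R)
    (i : interval R) (F : R * R -> R) (K : R) :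
  (0 < N)%N -> measurable_fun setT F -> (forall z, 0 <= F z) ->
  (forall y, enorm y \in i ->
     \sum_(0 <= k < N) F (x + rotc (k%:R * h) y) <= N%:R * K) ->
  (\int[lebesgue2 R]_(z in annulus x i) (F z)%:E <=
    K%:E * lebesgue2 R (annulus (0%R : R * R) i))%E.
Proof.
move=> N0 mF F0 hK.
apply: (@ge0_integral_mean_le _ _ R (lebesgue2 R) _ N
  (fun k y => F (x + rotc (k%:R * h) y)) _ K) => //.
- exact: measurable_annulus.
- move=> k; apply: measurableT_comp => //.
  apply: (measurableT_comp (measurable_fun_addl x)); exact: measurable_rotc.
- by move=> k _; rewrite ge0_integral_annulus_rotc.
- by move=> y; rewrite /annulus /= subr0 => /hK.
Qed.

Lemma lebesgue2_annulus_center (R : realType) (x : R * R) (i : interval R) :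
  lebesgue2 R (annulus x i) = lebesgue2 R (annulus (0 : R * R) i).
Proof.
rewrite -[LHS]mul1e -[RHS]mul1e.
rewrite -[LHS]integral_cst; last exact: measurable_annulus.
rewrite -[RHS]integral_cst; last exact: measurable_annulus.
by rewrite -(ge0_integral_annulus_rotc 0 x i (F := cst 1)).
Qed.

Lemma is_derive_subr_sin_cos (R : realType) (t : R) :
  is_derive t 1 (fun t : R => t - sin t * cos t) (2 * sin t ^+ 2).
Proof.
apply: is_derive_eq; rewrite /GRing.scale /=.
have := cos2Dsin2 t; nra.
Qed.

(** Substituting [x = - b cos t] makes the integrand smooth up to the end
    points. *)
Lemma integral_disk_chords (R : realType) (b : R) : 0 <= b ->
  (\int[@lebesgue_measure R]_(x in `[(- b)%R, b])
    (2 * Num.sqrt (b ^+ 2 - x ^+ 2))%:E = (pi * b ^+ 2)%:E)%E.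
Proof.
rewrite le_eqVlt => /predU1P[<-|b0].
  by rewrite oppr0 set_itv1 integral_set1 expr0n mulr0.
pose F t : R := - b * cos t.
have dF (t : R) : is_derive t 1 F (b * sin t).
  by apply: is_derive_eq; rewrite /GRing.scale /= ?mulr0; ring.
have F'E : F^`()%classic = fun t => b * sin t.
  by apply/funext => t; rewrite derive1E derive_val.
have cF : continuous F.
  by move=> t; apply: differentiable_continuous; apply/derivable1_diffP.
have cF' : continuous (fun t : R => b * sin t).
  by move=> t; apply: cvgMl_tmp; exact: continuous_sin.
have -> : `[(- b)%R, b]%classic = `[F 0, F pi]%classic.
  by rewrite /F cos0 cospi mulr1 mulrN1 opprK.
have pi0 := @pi_gt0 R.
rewrite integration_by_substitution_increasing//; last first.
- apply: continuous_subspaceT => x; apply: cvgMl_tmp.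
  apply: continuous_comp; last exact: sqrt_continuous.
  apply: cvgB; first exact: cvg_cst.
  exact: exprn_continuous.
- split; last 2 first.
  + by apply: cvg_at_right_filter; exact: cF.
  + by apply: cvg_at_left_filter; exact: cF.
  by move=> t _.
- rewrite F'E; apply/cvg_ex; exists (b * sin pi).
  by apply: cvg_at_left_filter; exact: cF'.
- rewrite F'E; apply/cvg_ex; exists (b * sin 0).
  by apply: cvg_at_right_filter; exact: cF'.
- by move=> t _; rewrite F'E; exact: cF'.
- move=> s t; rewrite !in_itv /= => sI tI st.
  by rewrite /F !mulNr ltrN2 ltr_pM2l// ltr_cos.
- exact: ltW.
transitivity (\int[@lebesgue_measure R]_(t in `[0%R, pi])
    (b ^+ 2 * (2 * sin t ^+ 2))%:E)%E.
  apply: eq_integral => t; rewrite inE /= in_itv /= => /andP[t0 tpi].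
  rewrite F'E /= !fctE; congr EFin.
  have -> : b ^+ 2 - F t ^+ 2 = (b * sin t) ^+ 2.
    by rewrite /F !exprMn sin2cos2 sqrrN; ring.
  rewrite sqrtr_sqr ger0_norm; first ring.
  by rewrite mulr_ge0 ?(ltW b0)// sin_ge0_pi// t0.
have d2 (t : R) : is_derive t 1 (fun t : R => b ^+ 2 * (t - sin t * cos t))
    (b ^+ 2 * (2 * sin t ^+ 2)).
  have h := is_derive_subr_sin_cos t.
  exact: is_deriveZ.
have c2 : continuous (fun t : R => b ^+ 2 * (t - sin t * cos t)).
  by move=> t; apply: differentiable_continuous; apply/derivable1_diffP.
rewrite (@continuous_FTC2 _ _ (fun t => b ^+ 2 * (t - sin t * cos t)))//.
- by rewrite sinpi sin0 !mul0r !subr0 mulr0 -EFinB subr0 mulrC.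
- apply: continuous_subspaceT => x; apply: cvgMl_tmp; apply: cvgMl_tmp.
  apply: (@continuous_comp _ _ _ (@sin R) (fun u : R => u ^+ 2)).
    exact: continuous_sin.
  exact: exprn_continuous.
- split; last 2 first.
  + by apply: cvg_at_right_filter; exact: c2.
  + by apply: cvg_at_left_filter; exact: c2.
  by move=> t _.
- by move=> t _; rewrite derive1E derive_val.
Qed.

Lemma lebesgue2_disk (R : realType) (b : R) : 0 <= b ->
  lebesgue2 R (annulus (0 : R * R) `]-oo, b]) = (pi * b ^+ 2)%:E.
Proof.
move=> b0; rewrite -integral_disk_chords//.
rewrite /product_measure1 /=.
rewrite [RHS]integral_mkcond; apply: eq_integral => x _.
have b2 y : (y \in xsection (annulus (0 : R * R) `]-oo, b]) x) =
    (x ^+ 2 + y ^+ 2 <= b ^+ 2).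
  rewrite mem_xsection; apply/idP/idP.
    rewrite in_setE /annulus /= in_itv /= subr0 => h.
    by rewrite -(sqr_enorm (x, y)) lerXn2r ?nnegrE ?enorm_ge0.
  move=> h; rewrite in_setE /annulus /= in_itv /= subr0.
  by rewrite -ler_sqr ?nnegrE ?enorm_ge0// sqr_enorm.
rewrite patchE; case: ifPn => xb.
  have := xb; rewrite inE /= in_itv /= => /andP[xb1 xb2].
  have d0 : 0 <= b ^+ 2 - x ^+ 2 by nra.
  set s := Num.sqrt (b ^+ 2 - x ^+ 2).
  have s0 : 0 <= s by exact: sqrtr_ge0.
  have s2 : s ^+ 2 = b ^+ 2 - x ^+ 2 by rewrite sqr_sqrtr.
  have -> : xsection (annulus (0 : R * R) `]-oo, b]) x = `[- s, s]%classic.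
    apply/seteqP; split => y /=.
      move=> /mem_set; rewrite b2 in_itv /= => h.
      by rewrite -ler_norml -ler_sqr ?nnegrE// real_normK ?num_real// s2; lra.
    rewrite in_itv /= -ler_norml => h; apply/set_mem; rewrite b2.
    have : `|y| ^+ 2 <= s ^+ 2 by rewrite lerXn2r ?nnegrE.
    by rewrite real_normK ?num_real// s2; lra.
  rewrite lebesgue_measure_itv /= lte_fin; case: ifPn => hs.
    by rewrite -EFinB; congr EFin; ring.
  by congr EFin; lra.
have -> : xsection (annulus (0 : R * R) `]-oo, b]) x = set0.
  apply/seteqP; split => y //= /mem_set; rewrite b2 => h.
  case/negP: xb; rewrite inE /= in_itv /= -ler_norml -ler_sqr ?nnegrE//.
  by rewrite real_normK ?num_real//; have := sqr_ge0 y; lra.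
by rewrite measure0.
Qed.

Lemma lebesgue2_annulus (R : realType) (a b : R) : 0 <= a -> a <= b ->
  lebesgue2 R (annulus (0 : R * R) `]a, b]) = (pi * (b ^+ 2 - a ^+ 2))%:E.
Proof.
move=> a0 ab; have b0 := le_trans a0 ab.
have -> : annulus (0 : R * R) `]a, b] =
   annulus (0 : R * R) `]-oo, b] `\` annulus (0 : R * R) `]-oo, a].
  apply/seteqP; split => z; rewrite /annulus /= !in_itv /= ltNge.
    by move=> /andP[/negP].
  by move=> [-> /negP ->].
rewrite measureD; last 3 first.
- exact: measurable_annulus.
- exact: measurable_annulus.
- by rewrite [ltLHS]lebesgue2_disk// ltry.
rewrite setIidr; last first.
  by move=> z; rewrite /annulus /= !in_itv /= => /le_trans; apply.
rewrite [X in (X - _)%E]lebesgue2_disk// [X in (_ - X)%E]lebesgue2_disk//.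
by rewrite -EFinB -mulrBr.
Qed.

Lemma ge0_integral_annulus_split (R : realType) (x : R * R) (a b : R)
    (F : R * R -> R) :
  a <= b -> measurable_fun setT F -> (forall z, 0 <= F z) ->
  (\int[lebesgue2 R]_(z in annulus x `]-oo, b]) (F z)%:E =
   \int[lebesgue2 R]_(z in annulus x `]-oo, a]) (F z)%:E +
   \int[lebesgue2 R]_(z in annulus x `]a, b]) (F z)%:E)%E.
Proof.
move=> ab mF F0; rewrite -ge0_integral_setU//.
- congr (integral _ _ _); apply/seteqP; split => z; rewrite /annulus /= !in_itv /=.
    by move=> zb; have [za|za] := leP (enorm (z - x)) a; [left|right].
  by case=> [/le_trans|/andP[]//]; exact.
- exact: measurable_annulus.
- exact: measurable_annulus.
- by apply/measurable_EFinP; exact: measurable_funTS.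
- by move=> z _; rewrite lee_fin.
- apply/disj_setPS => z []; rewrite /annulus /= !in_itv /= => za /andP[az _].
  by move: az; rewrite ltNge za.
Qed.

(** * A bound for the singular integral *)

Lemma continuous_sqrtVD (R : realType) (m : R) : 0 < m ->
  continuous (fun t : R => (Num.sqrt (`|t| + m))^-1).
Proof.
move=> m0 t; apply: cvgV; first by rewrite gt_eqF// sqrtr_gt0 ltr_wpDl.
apply: continuous_comp; last exact: sqrt_continuous.
by apply: cvgD; [exact: norm_continuous|exact: cvg_cst].
Qed.

Lemma integral_sqrtVD_le (R : realType) (m L : R) : 0 < m -> 0 < L ->
  (\int[@lebesgue_measure R]_(t in `[(- L)%R, L])
     ((Num.sqrt (`|t| + m))^-1)%:E <= (4 * Num.sqrt (L + m))%:E)%E.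
Proof.
move=> m0 L0; pose g (t : R) := ((Num.sqrt (`|t| + m))^-1)%:E.
change (\int[@lebesgue_measure R]_(t in `[(- L)%R, L]) g t
  <= (4 * Num.sqrt (L + m))%:E)%E.
have cg : continuous (fun t : R => (Num.sqrt (`|t| + m))^-1).
  exact: continuous_sqrtVD.
have mg : measurable_fun setT g.
  by apply/measurable_EFinP; exact: continuous_measurable_fun.
have g0 t : (0 <= g t)%E by rewrite lee_fin invr_ge0 sqrtr_ge0.
have half : (\int[@lebesgue_measure R]_(t in `[0%R, L]) g t <=
    (2 * Num.sqrt (L + m))%:E)%E.
  have dF (t : R) : -m < t -> is_derive t 1 (fun t : R => 2 * Num.sqrt (t + m))
      (Num.sqrt (t + m))^-1.
    move=> tm; have tm0 : 0 < t + m by lra.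
    have h1 : is_derive t 1 (fun t : R => t + m) 1.
      by apply: is_derive_eq; rewrite addr0.
    have h2 := is_derive1_sqrt tm0.
    have h3 := @is_derive1_comp _ Num.sqrt (fun t : R => t + m) t _ _ h2 h1.
    apply: (@is_derive_eq _ _ _ _ _ _ _ _ (is_deriveZ 2 h3)).
    rewrite /GRing.scale /=.
    by field; rewrite gt_eqF ?sqrtr_gt0.
  have cF (t : R) : -m < t -> {for t, continuous (fun t : R => 2 * Num.sqrt (t + m))}.
    move=> tm; have h := dF _ tm.
    by apply: differentiable_continuous; apply/derivable1_diffP.
  rewrite (@continuous_FTC2 _ _ (fun t => 2 * Num.sqrt (t + m)))//.
  - by rewrite -EFinB lee_fin gerBl mulr_ge0// sqrtr_ge0.
  - exact: continuous_subspaceT.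
  - split; last 2 first.
    + by apply: cvg_at_right_filter; apply: cF; lra.
    + by apply: cvg_at_left_filter; apply: cF; lra.
    move=> t; rewrite in_itv /= => /andP[t0 _].
    by have [] := dF t (lt_trans (_ : - m < 0) t0); first lra.
  - move=> t; rewrite in_itv /= => /andP[t0 _].
    have tm : - m < t by lra.
    by have h := dF t tm; rewrite derive1E derive_val ger0_norm// ltW.
have -> : `[- L, L]%classic = `[- L, 0]%classic `|` `]0, L]%classic.
  by rewrite -itv_bndbnd_setU// bnd_simp; lra.
rewrite ge0_integral_setU//; last 2 first.
- exact: measurable_funTS.
- apply/disj_setPS => t [] /=; rewrite !in_itv /= => /andP[_ t0] /andP[t1 _].
  lra.
rewrite integral_itv_obnd_cbnd; last exact: measurable_funTS.
have -> : (\int[@lebesgue_measure R]_(t in `[(- L)%R, 0%R]) g t =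
    \int[@lebesgue_measure R]_(t in `[0%R, L]) g t)%E.
  rewrite -{1}oppr0 integration_by_substitution_oppr//; last 2 first.
  - exact: ltW.
  - exact: continuous_subspaceT.
  by apply: eq_integral => t _; rewrite /g /= normrN.
apply: (le_trans (leeD half half)).
by rewrite -EFinD lee_fin; lra.
Qed.

(** The singularity at the origin of the plane is dominated by a singularity
    along the line [z.1 = 0], which is still integrable, so that the integral
    over an enclosing square factors.  The shift by [m > 0] keeps the
    integrand continuous, and the bound stays finite as [m] tends to 0. *)
Lemma integral_disk_sqrtVD_le (R : realType) (x : R * R) (i : interval R)
    (m L : R) : 0 < m -> 0 < L ->
  (forall z, annulus x i z -> enorm z <= L) ->
  (\int[lebesgue2 R]_(z in annulus x i) ((Num.sqrt (`|z.1| + m))^-1)%:E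
    <= (8 * L * Num.sqrt (L + m))%:E)%E.
Proof.
move=> m0 L0 sub.
pose g (t : R) := ((Num.sqrt (`|t| + m))^-1)%:E.
have mg : measurable_fun setT g.
  by apply/measurable_EFinP; apply: continuous_measurable_fun; exact: continuous_sqrtVD.
have g0 t : (0 <= g t)%E by rewrite lee_fin invr_ge0 sqrtr_ge0.
pose Q := (`[- L, L]%classic `*` `[- L, L]%classic : set (R * R)).
have mQ : measurable Q by exact: measurableX.
have mg1 : measurable_fun setT (fun z : R * R => g z.1).
  by apply: measurableT_comp => //; exact: measurable_fst.
have subQ : annulus x i `<=` Q.
  move=> z /sub zL; rewrite /Q /= !in_itv /= -!ler_norml; split.
    exact: le_trans (ler_normf_enorm z) zL.
  exact: le_trans (ler_norms_enorm z) zL.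
apply: (@le_trans _ _ (\int[lebesgue2 R]_(z in Q) g z.1)%E).
  apply: ge0_subset_integral => //; first exact: measurable_annulus.
  exact: measurable_funTS.
rewrite integral_mkcond.
rewrite (@fubini_tonelli1 _ _ (measurableTypeR R) (measurableTypeR R)); last 2 first.
- by apply/(measurable_restrictT _ mQ); exact: measurable_funTS.
- by move=> z; apply: erestrict_ge0 => ? _ /=.
rewrite (_ : (\int[lebesgue_measure]_x0 _)%E =
  (\int[@lebesgue_measure R]_(a in `[(- L)%R, L]) ((2 * L)%:E * g a))%E).
  rewrite ge0_integralZl//; last 2 first.
  - exact: measurable_funTS.
  - by rewrite lee_fin; lra.
  apply: (@le_trans _ _ ((2 * L)%:E * (4 * Num.sqrt (L + m))%:E)%E).
    by rewrite lee_pmul2l ?integral_sqrtVD_le// lte_fin; lra.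
  by rewrite -EFinM lee_fin; lra.
rewrite [RHS]integral_mkcond; apply: eq_integral => a _.
rewrite /fubini_F patchE; case: ifPn => aL.
  transitivity (\int[@lebesgue_measure R]_(b in `[(- L)%R, L]) (cst (g a) b))%E.
    rewrite [RHS]integral_mkcond; apply: eq_integral => b _.
    by rewrite !patchE /Q in_setX /= aL.
  rewrite integral_cst// muleC; congr (_ * _)%E.
  rewrite [LHS]lebesgue_measure_itv /= lte_fin ifT; last lra.
  by rewrite -EFinB; congr EFin; ring.
rewrite integral0_eq// => b _; rewrite patchE /Q in_setX /=.
by rewrite (negbTE aL).
Qed.

(** * The radius and the averages *)

Lemma ge0_integral_itv_translate (R : realType) (s a b : R) (f : R -> \bar R) :
  measurable_fun setT f -> (forall t, 0 <= f t)%E ->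
  (\int[@lebesgue_measure R]_(t in `]a, b]) f (t + s)%R =
   \int[@lebesgue_measure R]_(t in `](a + s)%R, (b + s)%R]) f t)%E.
Proof.
move=> mf f0; rewrite integral_mkcond [RHS]integral_mkcond.
rewrite -[RHS](ge0_integral_translate s).
- apply: eq_integral => t _; rewrite !patchE.
  congr (if _ then _ else _); apply/idP/idP.
    by rewrite !in_setE /= !in_itv /= ltrD2r lerD2r.
  by rewrite !in_setE /= !in_itv /= ltrD2r lerD2r.
- by apply/(measurable_restrictT _ (measurable_itv _)); exact: measurable_funTS.
- by move=> t; exact: erestrict_ge0.
Qed.

Lemma ge0_integral_period (R : realType) (p s : R) (f : R -> \bar R) :
  measurable_fun setT f -> (forall t, 0 <= f t)%E ->
  (forall t, f (t + p) = f t) -> 0 <= s <= p ->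
  (\int[@lebesgue_measure R]_(t in `]0%R, p]) f (t + s)%R =
   \int[@lebesgue_measure R]_(t in `]0%R, p]) f t)%E.
Proof.
move=> mf f0 fp /andP[s0 sp].
have split_at (a b c : R) : a <= b -> b <= c ->
    (\int[@lebesgue_measure R]_(t in `]a, c]) f t =
     \int[@lebesgue_measure R]_(t in `]a, b]) f t +
     \int[@lebesgue_measure R]_(t in `]b, c]) f t)%E.
  move=> ab bc; rewrite -ge0_integral_setU//.
  - by rewrite -itv_bndbnd_setU// bnd_simp.
  - exact: measurable_funTS.
  - apply/disj_setPS => t [] /=; rewrite !in_itv /= => /andP[_ t0] /andP[t1 _].
    lra.
rewrite ge0_integral_itv_translate// add0r.
rewrite (split_at s p (p + s))//; last lra.
rewrite (split_at 0 s p)// addeC; congr (_ + _)%E.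
have := ge0_integral_itv_translate p 0 s mf f0.
rewrite add0r [s + p]addrC => <-.
by apply: eq_integral => t _; rewrite fp.
Qed.

Definition max_radius (R : realType) (c M : R) (z : R * R) : R :=
  Num.max (c * enorm z) M.

Lemma ger_powRN (R : realType) (a b alpha : R) : 0 < a -> a <= b -> 0 <= alpha ->
  b `^ (- alpha) <= a `^ (- alpha).
Proof.
move=> a0 ab al0; rewrite !powRN lef_pV2 ?posrE ?powR_gt0//; last first.
  exact: lt_le_trans ab.
by apply: ge0_ler_powR => //; rewrite nnegrE ltW// (lt_le_trans a0).
Qed.

Lemma le_max_radius (R : realType) (c M : R) (z : R * R) : M <= max_radius c M z.
Proof. by rewrite /max_radius le_max lexx orbT. Qed.

Lemma max_radius_gt0 (R : realType) (c M : R) (z : R * R) : 0 < M -> 0 < max_radius c M z.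
Proof. by move=> M0; exact: lt_le_trans (le_max_radius c M z). Qed.

Lemma measurable_powR_max_radius (R : realType) (c M p : R) :
  measurable_fun setT (fun z : R * R => max_radius c M z `^ p).
Proof.
apply: (measurableT_comp (measurable_powR p)); apply: measurable_maxr => //.
by apply: measurable_funM => //; exact: measurable_enorm.
Qed.

(** The truncation by [M] only decreases the function: up to the constant
    [c `^ (- alpha)] it is at most the homogeneous function
    [enorm z `^ (- alpha)], with equality at [x]. *)
Lemma powRN_max_radius_le (R : realType) (c M alpha : R) (x z : R * R) :
  0 < M -> 0 <= alpha -> M < c * enorm x -> 0 < enorm x -> 0 < enorm z ->
  max_radius c M z `^ (- alpha) <=
    max_radius c M x `^ (- alpha) * (enorm z / enorm x) `^ (- alpha).
Proof.
move=> M0 a0 Mx x0 z0.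
have -> : max_radius c M x = c * enorm x by apply/max_idPl/ltW.
have cx0 : 0 < c * enorm x by exact: lt_trans Mx.
rewrite -powRM ?divr_ge0 ?(ltW cx0) ?(ltW x0) ?(ltW z0)//.
apply: ger_powRN => //.
  by rewrite mulr_gt0// divr_gt0.
have -> : c * enorm x * (enorm z / enorm x) = c * enorm z.
  by field; rewrite gt_eqF.
by rewrite /max_radius le_max lexx.
Qed.

Lemma sum_powRN_max_radius_rotc_le (R : realType) (n : nat) (h c M alpha s B : R)
    (x y : R * R) :
  0 < M -> M < c * enorm x -> 0 < enorm x ->
  2 ^+ n * h = 2 * pi -> enorm y = s * enorm x ->
  expR (- B) <= `|1 - s| -> 1 + s <= expR B ->
  0 <= alpha -> alpha * B <= 3^-1 ->
  \sum_(0 <= k < 2 ^ n) max_radius c M (x + rotc (k%:R * h) y) `^ (- alpha) <=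
    max_radius c M x `^ (- alpha) *
    (2 ^+ n * (1 + (alpha * B) ^+ 2) - alpha * ln `|1 - s ^+ (2 ^ n)|).
Proof.
move=> M0 Mx x0 hE ys sB1 sB2 a0 aB.
apply: (@le_trans _ _ (\sum_(0 <= k < 2 ^ n) (max_radius c M x `^ (- alpha) *
    (enorm (x + rotc (k%:R * h) y) / enorm x) `^ (- alpha)))).
  apply: ler_sum => k _; apply: powRN_max_radius_le => //.
  apply: (lt_le_trans _ (ler_dist_enorm _ _)).
  rewrite enorm_rotc ys -{1}(mul1r (enorm x)) -mulrBl normrM.
  rewrite (gtr0_norm x0) mulr_gt0//.
  by apply: lt_le_trans sB1; exact: expR_gt0.
rewrite -mulr_sumr ler_wpM2l ?powR_ge0//.
exact: sum_powRN_rotc_le.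
Qed.

Lemma measurable_circle_pt (R : realType) (x : R * R) (rho : R) :
  measurable_fun setT (circle_pt x rho).
Proof.
have mc : measurable_fun setT (@cos R).
  exact: continuous_measurable_fun (@continuous_cos R).
have ms : measurable_fun setT (@sin R).
  exact: continuous_measurable_fun (@continuous_sin R).
by apply/measurable_fun_pairP; split; apply: measurable_funD => //;
  apply: measurable_funM.
Qed.

Lemma circle_avg_le (R : realType) (N : nat) (x : R * R) (rho K : R)
    (f : R * R -> R) :
  (0 < N)%N -> measurable_fun setT f -> (forall z, 0 <= f z) ->
  (forall t, \sum_(0 <= k < N)
     f (x + rotc (k%:R * (2 * pi / N%:R)) (rotc t (rho, 0))) <= N%:R * K) ->
  (circle_avg x rho f <= K%:E)%E.
Proof.
move=> N0 mf f0 hK.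
have p0 : 0 < 2 * pi :> R by rewrite mulr_gt0// pi_gt0.
have Nr0 : 0 < N%:R :> R by rewrite ltr0n.
have mF : measurable_fun setT (fun t => f (circle_pt x rho t)).
  by apply: measurableT_comp => //; exact: measurable_circle_pt.
have mFE : measurable_fun setT (fun t => (f (circle_pt x rho t))%:E).
  exact/measurable_EFinP.
rewrite /circle_avg -integral_itv_obnd_cbnd; last exact: measurable_funTS.
apply: (@le_trans _ _ ((2 * pi)^-1%:E *
    (K%:E * @lebesgue_measure R `]0%R, (2 * pi)%R]))%E); last first.
  rewrite [X in (_ * (_ * X))%E](lebesgue_measure_itv `]0%R, (2 * pi)%R]) /= lte_fin p0.
  rewrite -EFinB subr0 -!EFinM lee_fin mulrC mulrK// unitfE gt_eqF//.
rewrite lee_pmul2l ?lte_fin ?invr_gt0//.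
apply: (@ge0_integral_mean_le _ _ R (@lebesgue_measure R) _ N
  (fun k t => f (circle_pt x rho (t + k%:R * (2 * pi / N%:R)))) _ K) => //.
- move=> k; apply: (measurableT_comp mF); exact: measurable_funD.
- move=> k kN; apply: (ge0_integral_period mFE) => //.
  + by move=> t; rewrite lee_fin.
  + by move=> t; rewrite /circle_pt mulr_natl cosD2pi sinD2pi.
  + rewrite mulr_ge0// ?divr_ge0 ?(ltW p0)//=.
    rewrite mulrCA ger_pMr// ler_pdivrMr// mul1r ler_nat ltnW//.
- move=> t _; apply: le_trans (hK t); rewrite le_eqVlt; apply/orP; left.
  apply/eqP; apply: eq_bigr => k _.
  rewrite circle_ptE [t + _]addrC rotcD. by [].
Qed.

Lemma disk_avg_le (R : realType) (x : R * R) (rho K : R) (f : R * R -> R) :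
  0 < rho -> (\int[lebesgue2 R]_(z in annulus x `]-oo, rho]) (f z)%:E <=
    (K * (pi * rho ^+ 2))%:E)%E ->
  (disk_avg x rho f <= K%:E)%E.
Proof.
move=> rho0 hK; have p0 : 0 < pi * rho ^+ 2 by rewrite mulr_gt0 ?pi_gt0 ?exprn_gt0.
rewrite /disk_avg.
have -> : edisk x rho = annulus x `]-oo, rho].
  by apply/seteqP; split => z; rewrite /edisk /annulus /= in_itv.
apply: (@le_trans _ _ ((pi * rho ^+ 2)^-1%:E * (K * (pi * rho ^+ 2))%:E)%E).
  by rewrite lee_pmul2l// lte_fin invr_gt0.
by rewrite -EFinM lee_fin mulrC mulfK// gt_eqF.
Qed.

(** * Averages over circles *)

(** By Bernoulli's inequality; powers of 2 are the orders of rotation in use. *)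
Lemma exists_expr2_ge (R : realType) (q K : R) : 1 < q ->
  exists n : nat, K <= (2 ^ n)%:R /\ K <= q ^+ (2 ^ n).
Proof.
move=> q1.
pose n := Num.truncn (`|K| + `|K| / (q - 1)).
have q10 : 0 < q - 1 by rewrite subr_gt0.
have hn : `|K| + `|K| / (q - 1) <= (2 ^ n)%:R.
  apply: ltW; apply: (lt_le_trans (truncnS_gt _)).
  by rewrite ler_nat; exact: ltn_expl.
have K0 : 0 <= `|K| / (q - 1) by rewrite divr_ge0// ltW.
exists n; split.
  by apply: le_trans hn; rewrite (le_trans (ler_norm K))// lerDl.
have bern m : m%:R * (q - 1) <= q ^+ m.
  elim: m => [|m IH]; first by rewrite mul0r.
  rewrite exprS -natr1.
  have : 1 <= q ^+ m by rewrite exprn_ege1// ltW.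
  nra.
apply: le_trans (bern _); rewrite (le_trans (ler_norm K))//.
by rewrite -ler_pdivrMr// (le_trans _ hn)// lerDr.
Qed.

Lemma exists_expR_bounds (R : realType) (a b : R) : 0 < a -> 1 < b ->
  exists B : R, [/\ 0 < B, expR (- B) <= a & b <= expR B].
Proof.
move=> a0 b1; exists (Num.max (ln b) (- ln a)); split.
- by rewrite lt_max ln_gt0.
- by rewrite -[leRHS]lnK ?posrE// ler_expR lerNl le_max lexx orbT.
- by rewrite -[leLHS]lnK ?posrE ?(lt_trans ltr01)// ler_expR le_max lexx.
Qed.

Lemma sigma_supermedian_powRN (R : realType) (c M : R) : 1 < c -> 0 < M ->
  exists2 alpha0 : R, 0 < alpha0 & forall alpha : R, 0 < alpha <= alpha0 ->
    sigma_supermedian (max_radius c M) (fun x => max_radius c M x `^ (- alpha)).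
Proof.
move=> c1 M0.
(* 3 makes the gain [ln (3 - 1)] strictly positive *)
have [n [_ cn]] := exists_expr2_ge 3 c1.
have ln2 : 0 < ln (2 : R) by rewrite ln_gt0// ltr1n.
have c0 : 0 < c by lra.
have [B [B0 B1 B2]] : exists B : R,
    [/\ 0 < B, expR (- B) <= `|1 - c| & 1 + c <= expR B].
  by apply: exists_expR_bounds; rewrite ?normr_gt0 ?subr_eq0 ?lt_eqF//; lra.
pose N : R := 2 ^+ n.
have N0 : 0 < N by rewrite exprn_gt0.
exists (Num.min ((3 * B)^-1) (ln 2 / (N * B ^+ 2))).
  by rewrite lt_min invr_gt0 divr_gt0 ?mulr_gt0 ?exprn_gt0.
move=> alpha /andP[a0]; rewrite le_min => /andP[aB aN] x.
have aB' : alpha * B <= 3^-1.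
  by move: aB; rewrite -[leRHS]div1r ler_pdivlMr ?mulr_gt0//; lra.
have mf := measurable_powR_max_radius c M (- alpha).
have f0 z : 0 <= max_radius c M z `^ (- alpha) by exact: powR_ge0.
have [cx|cx] := leP (c * enorm x) M.
  have rx : max_radius c M x = M by exact/max_idPr.
  apply: (@circle_avg_le _ 1) => // t.
  rewrite big_nat1 mul1r rx.
  by apply: ger_powRN => //; [exact: le_max_radius|exact: ltW].
have x0 : 0 < enorm x by rewrite -(pmulr_rgt0 _ c0) (lt_trans M0).
apply: (@circle_avg_le _ (2 ^ n)) => //; first by rewrite expn_gt0.
move=> t.
have rx : max_radius c M x = c * enorm x by apply/max_idPl/ltW.
apply: (le_trans (sum_powRN_max_radius_rotc_le (s := c) (B := B) M0 cx x0 _ _ B1 B2 (ltW a0) aB')).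
- by rewrite natrX mulrC divfK// gt_eqF.
- rewrite enorm_rotc; apply: enorm_eq => /=; last by rewrite rx expr0n addr0.
  by rewrite mulr_ge0 ?(ltW c0) ?(ltW x0).
- rewrite mulrC ler_wpM2r// natrX -/N.
  have : ln 2 <= ln `|1 - c ^+ (2 ^ n)|.
    rewrite ler_ln ?posrE//; rewrite ltr0_norm; lra.
  have : alpha * (N * B ^+ 2) <= ln 2 by rewrite -ler_pdivlMr ?mulr_gt0 ?exprn_gt0.
  rewrite exprMn; set l := ln `|_|; nra.
Qed.

(** * Averages over disks *)

(** The two terms on the right come from the arithmetic-geometric mean
    inequality for [v `^ (- 1 / 4)]: a small [tau] makes the integral of the
    second one negligible, and the first one is then integrated over a set of
    small measure. *)
Lemma powRN_le_linear (R : realType) (v alpha tau : R) :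
  0 < v -> 0 <= alpha <= 8^-1 -> 0 < tau ->
  v `^ (- alpha) <= 1 + 4 * alpha * (tau^-1 + tau * (Num.sqrt v)^-1).
Proof.
move=> v0 /andP[a0 a8] t0.
have ti0 : 0 < tau^-1 by rewrite invr_gt0.
have si0 : 0 < (Num.sqrt v)^-1 by rewrite invr_gt0 sqrtr_gt0.
have [v1|v1] := leP 1 v.
  rewrite powRE_gt0// (le_trans (y := 1))//.
    by rewrite expR_le1 mulNr oppr_le0 mulr_ge0// ln_ge0.
  by rewrite lerDl !mulr_ge0// addr_ge0// ?mulr_ge0 ?ltW.
set p := - ln v.
have p0 : 0 < p by rewrite oppr_gt0 ln_lt0// v0.
set q := expR (p / 4).
have q0 : 0 < q by exact: expR_gt0.
have -> : (Num.sqrt v)^-1 = q ^+ 2.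
  have vE : v = (expR (- p / 2)) ^+ 2.
    by rewrite expr2 -expRD -splitr /p opprK lnK.
  rewrite vE sqrtr_sqr ger0_norm ?expR_ge0// mulNr expRN invrK.
  by rewrite expr2 -expRD; congr expR; lra.
have -> : v `^ (- alpha) = expR (alpha * p).
  by rewrite powRE_gt0// mulNr /p mulrN.
have h1 : expR (alpha * p) <= 1 + alpha * p * expR (alpha * p).
  have := expR_ge1Dx (- (alpha * p)).
  have := expRxMexpNx_1 (alpha * p); have := expR_gt0 (alpha * p); nra.
set w := expR (p / 8).
have w0 : 0 < w by exact: expR_gt0.
have qw : q = w ^+ 2 by rewrite expr2 -expRD; congr expR; lra.
have h2 : p <= 8 * w by have := expR_ge1Dx (p / 8); rewrite -/w; lra.
have h3 : expR (alpha * p) <= w by rewrite ler_expR; nra.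
have h4 : p * expR (alpha * p) <= 8 * q.
  rewrite qw expr2 mulrA; by apply: ler_pM => //; rewrite ?expR_ge0 ?ltW.
have h5 : 2 * q <= tau^-1 + tau * q ^+ 2.
  have -> : tau^-1 + tau * q ^+ 2 = 2 * q + tau * (tau^-1 - q) ^+ 2.
    by field; rewrite gt_eqF.
  by rewrite lerDl mulr_ge0 ?sqr_ge0// ltW.
apply: (le_trans h1); rewrite lerD2l -mulrA [4 * _]mulrC -mulrA ler_wpM2l//.
lra.
Qed.

(** Away from the critical radius [enorm x] the mean over rotations is bounded
    pointwise, where [e] is the loss, or if negative the gain, relative to the
    average 1. *)
Lemma integral_annulus_powRN_le (R : realType) (n : nat)
    (c M alpha B e : R) (x : R * R) (i : interval R) :
  0 < M -> M < c * enorm x -> 0 < enorm x -> 0 <= alpha -> alpha * B <= 3^-1 ->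
  (forall s, 0 <= s -> s * enorm x \in i ->
     [/\ expR (- B) <= `|1 - s|, 1 + s <= expR B &
         - ln `|1 - s ^+ (2 ^ n)| <= (2 ^ n)%:R * e]) ->
  (\int[lebesgue2 R]_(z in annulus x i) (max_radius c M z `^ (- alpha))%:E <=
    (max_radius c M x `^ (- alpha) * (1 + (alpha * B) ^+ 2 + alpha * e))%:E *
    lebesgue2 R (annulus (0%R : R * R) i))%E.
Proof.
move=> M0 Mx x0 a0 aB hi.
have N0 : 0 < (2 ^ n)%:R :> R by rewrite ltr0n expn_gt0.
apply: (@integral_annulus_le _ (2 ^ n) (2 * pi / (2 ^ n)%:R)).
- by rewrite expn_gt0.
- exact: measurable_powR_max_radius.
- by move=> z; exact: powR_ge0.
move=> y yi; pose s := enorm y / enorm x.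
have ys : enorm y = s * enorm x by rewrite divfK ?gt_eqF.
have s0 : 0 <= s by rewrite divr_ge0 ?enorm_ge0.
have si : s * enorm x \in i by rewrite -ys.
have [b1 b2 b3] := hi s s0 si.
apply: (le_trans (sum_powRN_max_radius_rotc_le (s := s) (B := B) M0 Mx x0 _ ys b1 b2 a0 aB)).
  by rewrite -natrX mulrC divfK// gt_eqF.
rewrite mulrCA ler_wpM2l ?powR_ge0// -natrX [leRHS]mulrDr lerD2l -mulrN.
by rewrite [leRHS]mulrCA ler_wpM2l.
Qed.

(** The annulus may contain the singularity; the first term is small with the
    measure of the annulus, the second one with [tau]. *)
Lemma integral_annulus_powRN_singular_le (R : realType)
    (c M alpha tau : R) (x : R * R) (a b : R) :
  1 < c -> 0 < M -> M < c * enorm x -> 0 < enorm x -> 0 <= alpha <= 8^-1 ->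
  0 < tau -> 0 <= a -> a <= b -> b <= c * enorm x ->
  (\int[lebesgue2 R]_(z in annulus x `]a, b]) (max_radius c M z `^ (- alpha))%:E <=
    (max_radius c M x `^ (- alpha) *
     ((1 + 4 * alpha / tau) * (pi * (b ^+ 2 - a ^+ 2)) +
      32 * (1 + c) * (2 + c) * alpha * tau * enorm x ^+ 2))%:E)%E.
Proof.
move=> c1 M0 Mx x0 a01 t0 a0 ab bx.
have /andP[al0 _] := a01.
set X := enorm x; set f0 := max_radius c M x `^ (- alpha).
have rx : max_radius c M x = c * X by apply/max_idPl/ltW.
have c0 : 0 < c by lra.
have cX0 : 0 < c * X by rewrite mulr_gt0.
have f00 : 0 < f0 by rewrite powR_gt0// rx.
pose m := M / c.
have m0 : 0 < m by rewrite divr_gt0.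
have mX : m < X by rewrite ltr_pdivrMr// mulrC.
pose g (z : R * R) : R := (Num.sqrt (`|z.1| + m))^-1.
have g0 z : 0 <= g z by rewrite invr_ge0 sqrtr_ge0.
have mg : measurable_fun setT g.
  apply: (@measurableT_comp _ _ _ _ _ _ (fun t : R => (Num.sqrt (`|t| + m))^-1)).
    by apply: continuous_measurable_fun; exact: continuous_sqrtVD.
  exact: measurable_fst.
set A := annulus x _; have mA : measurable A by exact: measurable_annulus.
pose k1 := f0 * (1 + 4 * alpha / tau).
pose k2 := f0 * (4 * alpha * tau * Num.sqrt (2 * X)).
have k10 : 0 <= k1.
  by rewrite mulr_ge0 ?(ltW f00)// addr_ge0// divr_ge0 ?(ltW t0)// mulr_ge0.
have k20 : 0 <= k2.
  by rewrite mulr_ge0 ?(ltW f00)// !mulr_ge0 ?sqrtr_ge0// ltW.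
have ptw z : max_radius c M z `^ (- alpha) <= k1 + k2 * g z.
  have rz0 := max_radius_gt0 c z M0.
  pose v := max_radius c M z / (c * X).
  have v0 : 0 < v by rewrite divr_gt0.
  have -> : max_radius c M z = c * X * v by rewrite mulrC divfK// gt_eqF.
  rewrite powRM ?(ltW cX0) ?(ltW v0)// -rx -/f0.
  have -> : k1 + k2 * g z = f0 * (1 + 4 * alpha *
      (tau^-1 + tau * (Num.sqrt (2 * X) * g z))) by rewrite /k1 /k2; ring.
  rewrite ler_wpM2l ?(ltW f00)//; apply: (le_trans (powRN_le_linear v0 a01 t0)).
  rewrite lerD2l ler_wpM2l ?mulr_ge0// lerD2l ler_wpM2l ?(ltW t0)//.
  have u0 : 0 < `|z.1| + m by rewrite ltr_wpDl.
  rewrite /g ler_pdivlMr ?sqrtr_gt0// mulrC ler_pdivrMr ?sqrtr_gt0//.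
  rewrite -sqrtrM; last by rewrite mulr_ge0// ltW.
  rewrite ler_wsqrtr// /v mulrA ler_pdivlMr//.
  have h1 : c * `|z.1| <= max_radius c M z.
    rewrite /max_radius le_max; apply/orP; left.
    by rewrite ler_wpM2l ?(ltW c0)// ler_normf_enorm.
  have h2 := le_max_radius c M z.
  have h3 : c * m = M by rewrite /m mulrC divfK// gt_eqF.
  have X0 : 0 < X by exact: x0.
  nra.
have mf : measurable_fun A (fun z => (max_radius c M z `^ (- alpha))%:E).
  by apply/measurable_EFinP; apply: measurable_funTS; exact: measurable_powR_max_radius.
have mgE : measurable_fun A (fun z => (g z)%:E).
  by apply/measurable_EFinP; exact: measurable_funTS.
apply: (@le_trans _ _ (\int[lebesgue2 R]_(z in A) (k1%:E + k2%:E * (g z)%:E))%E).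
  apply: ge0_le_integral => //.
  - by move=> z _; rewrite lee_fin powR_ge0.
  - apply: emeasurable_funD => //; exact: measurable_funeM.
  - by move=> z _; rewrite -EFinM -EFinD lee_fin.
rewrite ge0_integralD//; last 2 first.
- by move=> z _; rewrite -EFinM lee_fin mulr_ge0.
- exact: measurable_funeM.
rewrite ge0_integralZl//; last by move=> z _; rewrite lee_fin.
rewrite integral_cst//.
have X0 : 0 < X by exact: x0.
pose L := (1 + c) * X.
have L0 : 0 < L by rewrite mulr_gt0//; lra.
have hG : (\int[lebesgue2 R]_(z in A) (g z)%:E <= (8 * L * Num.sqrt (L + m))%:E)%E.
  apply: integral_disk_sqrtVD_le => // z; rewrite /annulus /= in_itv /= => /andP[_ zb].
  have := ler_enormD x (z - x); rewrite addrC subrK => /le_trans; apply.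
  by rewrite /L mulrDl mul1r lerD2l (le_trans zb).
rewrite [X in (_ * X + _)%E]lebesgue2_annulus_center.
rewrite [X in (_ * X + _)%E]lebesgue2_annulus//.
apply: (@le_trans _ _ (k1%:E * (pi * (b ^+ 2 - a ^+ 2))%:E +
   k2%:E * (8 * L * Num.sqrt (L + m))%:E)%E).
  by rewrite leeD2l// lee_wpmul2l.
rewrite -!EFinM -EFinD lee_fin /k1 /k2 -!mulrA -mulrDr ler_wpM2l ?(ltW f00)//.
rewrite mulrA -/(_ / _) lerD2l.
have hs : Num.sqrt (2 * X) * Num.sqrt (L + m) <= (2 + c) * X.
  rewrite -sqrtrM ?mulr_ge0 ?(ltW X0)//.
  rewrite -[leRHS]ger0_norm ?mulr_ge0 ?(ltW X0)//; last lra.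
  rewrite -sqrtr_sqr ler_wsqrtr//.
  have : L + m <= (2 + c) * X by rewrite /L; lra.
  have : 2 * X <= (2 + c) * X by nra.
  nra.
have : 4 * alpha * tau * (8 * L) * (Num.sqrt (2 * X) * Num.sqrt (L + m)) <=
   4 * alpha * tau * (8 * L) * ((2 + c) * X).
  apply: ler_wpM2l hs; apply: mulr_ge0; last exact: mulr_ge0 (ltW L0).
  by rewrite !mulr_ge0// ltW.
have -> : 4 * alpha * tau * (8 * L) * ((2 + c) * X) =
  32 * ((1 + c) * ((2 + c) * (alpha * (tau * X ^+ 2)))) by rewrite /L; ring.
move=> h; apply: (le_trans _ h); rewrite le_eqVlt; apply/orP; left; apply/eqP.
by rewrite /L; ring.
Qed.

(** In units of [enorm x ^+ 2], the left-hand side adds up the bounds for the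
    disk of radius [1 - d], the singular annulus, and the two outer annuli.
    The gain [alpha * k] of the last one, [k] being its area times
    [l = ln c'], outweighs the losses: a quarter of it is spent on each of the
    two terms of the singular annulus, and the rest on the error terms
    [eta + alpha * eps]. *)
Lemma annuli_budget (R : realType) (p alpha tau d eps eta k W c c' l : R) :
  0 < p -> 0 < alpha -> 0 < tau -> 0 < d -> 0 < eps -> 1 < c' -> c' < c ->
  k = p * l * (c ^+ 2 - c' ^+ 2) ->
  16 * W * tau <= k -> 64 * p * d <= k * tau -> 4 * p * c ^+ 2 * eps <= k ->
  0 <= eta <= alpha * eps ->
  (1 + eta + alpha * eps) * (p * (1 - d) ^+ 2) +
  ((1 + 4 * alpha / tau) * (p * ((1 + d) ^+ 2 - (1 - d) ^+ 2)) +
     4 * W * alpha * tau) +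
  (1 + eta + alpha * eps) * (p * (c' ^+ 2 - (1 + d) ^+ 2)) +
  (1 + eta + alpha * (eps - l)) * (p * (c ^+ 2 - c' ^+ 2)) <= p * c ^+ 2.
Proof.
move=> p0 a0 t0 d0 e0 c'1 c'c kE hW hd he /andP[eta0 etae].
have h1 : 16 * p * d / tau <= k / 4.
  by rewrite ler_pdivrMr//; lra.
have -> : (1 + eta + alpha * eps) * (p * (1 - d) ^+ 2) +
  ((1 + 4 * alpha / tau) * (p * ((1 + d) ^+ 2 - (1 - d) ^+ 2)) +
     4 * W * alpha * tau) +
  (1 + eta + alpha * eps) * (p * (c' ^+ 2 - (1 + d) ^+ 2)) +
  (1 + eta + alpha * (eps - l)) * (p * (c ^+ 2 - c' ^+ 2)) =
  p * c ^+ 2 + alpha * (16 * p * d / tau + 4 * W * tau - k) +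
  (eta + alpha * eps) * (p * c ^+ 2) - (eta + alpha * eps) * (4 * p * d).
  by rewrite kE; field; rewrite gt_eqF.
have h2 : alpha * (16 * p * d / tau + 4 * W * tau - k) <= alpha * (- (k / 2)).
  by rewrite ler_pM2l//; lra.
have h3 : (eta + alpha * eps) * (p * c ^+ 2) <= (2 * alpha * eps) * (p * c ^+ 2).
  by rewrite ler_wpM2r; [|rewrite mulr_ge0 ?sqr_ge0 ?ltW|lra].
have h4 : 0 <= (eta + alpha * eps) * (4 * p * d).
  by rewrite mulr_ge0 ?addr_ge0 ?mulr_ge0 ?(ltW p0) ?(ltW a0) ?(ltW e0) ?(ltW d0).
have h5 : alpha * (4 * p * c ^+ 2 * eps) <= alpha * k by rewrite ler_pM2l.
lra.
Qed.

Lemma ln_norm1B_ge_in (R : realType) (d s : R) (N : nat) :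
  0 < d -> 2 <= (1 + d) ^+ N -> 0 <= s -> s <= 1 - d ->
  - ln `|1 - s ^+ N| <= ln 2.
Proof.
move=> d0 h2 s0 sd.
have sN : s ^+ N <= 2^-1.
  rewrite -div1r ler_pdivlMr//.
  apply: (@le_trans _ _ (s ^+ N * (1 + d) ^+ N)).
    by rewrite ler_wpM2l// exprn_ge0.
  by rewrite -exprMn exprn_ile1//; nra.
rewrite lerNl -lnV ?posrE// ler_ln ?posrE ?invr_gt0//; last first.
  by rewrite normr_gt0; apply/eqP; lra.
by rewrite ger0_norm; lra.
Qed.

Lemma ln_norm1B_ge_out (R : realType) (q s : R) (N : nat) :
  0 < q -> 2 <= q ^+ N -> q <= s -> N%:R * ln q - ln 2 <= ln `|1 - s ^+ N|.
Proof.
move=> q0 h2 qs.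
have sN : q ^+ N <= s ^+ N by rewrite lerXn2r// nnegrE ltW// (lt_le_trans q0).
rewrite mulr_natl -lnXn// -ln_div ?posrE ?exprn_gt0//.
have n0 : 0 < `|1 - s ^+ N| by rewrite normr_gt0; apply/eqP; lra.
rewrite ler_ln ?posrE ?divr_gt0 ?exprn_gt0//.
by rewrite ler_pdivrMr// ltr0_norm; lra.
Qed.

(** The hypotheses list what the parameters have to satisfy: [tau], then [d]
    and [eps], are small with respect to the gain [k], the order [2 ^ n] of
    averaging is large depending on [d] and [eps], and [alpha] is small
    depending on everything else. *)
Lemma disk_avg_powRN_le (R : realType) (n : nat)
    (c M c' d eps tau k B alpha : R) (x : R * R) :
  1 < c' -> c' < c -> 0 < d -> d <= 2^-1 -> 1 + d <= c' ->
  0 < eps -> 0 < tau ->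
  k = pi * ln c' * (c ^+ 2 - c' ^+ 2) ->
  16 * (8 * (1 + c) * (2 + c)) * tau <= k -> 64 * pi * d <= k * tau ->
  4 * pi * c ^+ 2 * eps <= k ->
  ln 2 <= (2 ^ n)%:R * eps -> 2 <= (1 + d) ^+ (2 ^ n) ->
  expR (- B) <= d -> 1 + c <= expR B ->
  0 < alpha -> alpha <= 8^-1 -> alpha * B <= 3^-1 -> alpha * B ^+ 2 <= eps ->
  0 < M -> M < c * enorm x ->
  (disk_avg x (max_radius c M x) (fun z => max_radius c M z `^ (- alpha))%R <=
    (max_radius c M x `^ (- alpha))%:E)%E.
Proof.
move=> c'1 c'c d0 d1 dc' e0 t0 kE hW hd he hn hn2 B1 B2 a0 a8 aB' aB2 M0 cx.
have c1 : 1 < c by exact: lt_trans c'c.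
have c0 : 0 < c by exact: lt_trans c1.
have p0 := @pi_gt0 R.
have x0 : 0 < enorm x by rewrite -(pmulr_rgt0 _ c0) (lt_trans M0).
have aBe : 0 <= (alpha * B) ^+ 2 <= alpha * eps.
  by rewrite sqr_ge0 /= exprMn expr2 -mulrA ler_pM2l.
have a8' : 0 <= alpha <= 8^-1 by rewrite (ltW a0).
have mf := measurable_powR_max_radius c M (- alpha).
have f0 z : 0 <= max_radius c M z `^ (- alpha) by exact: powR_ge0.
apply: (disk_avg_le (max_radius_gt0 c x M0)).
have rx : max_radius c M x = c * enorm x by apply/max_idPl/ltW.
set X := enorm x in cx rx x0 *.
set F := max_radius c M x `^ (- alpha).
have F0 : 0 <= F by exact: f0.
(* inner disk, singular annulus, and the two outer annuli *)
rewrite [X in annulus _ `]-oo, X]]rx [X in pi * X ^+ 2]rx.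
rewrite (@ge0_integral_annulus_split _ x (c' * X))//; last by rewrite ler_pM2r// ltW.
rewrite (@ge0_integral_annulus_split _ x ((1 + d) * X))//; last by rewrite ler_pM2r.
rewrite (@ge0_integral_annulus_split _ x ((1 - d) * X))//; last by rewrite ler_pM2r//; lra.
have g1 : (\int[lebesgue2 R]_(z in annulus x `]-oo, ((1 - d) * X)%R])
    (max_radius c M z `^ (- alpha))%:E <=
    (F * (1 + (alpha * B) ^+ 2 + alpha * eps) * (pi * ((1 - d) * X) ^+ 2))%:E)%E.
  rewrite EFinM -lebesgue2_disk; last by rewrite mulr_ge0 ?(ltW x0)//; lra.
  apply: (integral_annulus_powRN_le (n := n)) => //; first exact: ltW.
  move=> s s0; rewrite in_itv /= ler_pM2r// => sd; split.
  - by rewrite (le_trans B1)// ger0_norm; lra.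
  - by apply: le_trans B2; lra.
  - by apply: le_trans hn; exact: ln_norm1B_ge_in sd.
have g2 := @integral_annulus_powRN_singular_le R c M alpha tau x
  ((1 - d) * X) ((1 + d) * X) c1 M0 cx x0 a8' t0.
have g3 : (\int[lebesgue2 R]_(z in annulus x `]((1 + d) * X)%R, (c' * X)%R])
    (max_radius c M z `^ (- alpha))%:E <=
    (F * (1 + (alpha * B) ^+ 2 + alpha * eps) *
     (pi * ((c' * X) ^+ 2 - ((1 + d) * X) ^+ 2)))%:E)%E.
  rewrite EFinM -lebesgue2_annulus; last 2 first.
  - by rewrite mulr_ge0 ?(ltW x0)//; lra.
  - by rewrite ler_pM2r.
  apply: (integral_annulus_powRN_le (n := n)) => //; first exact: ltW.
  move=> s s0; rewrite in_itv /= ltr_pM2r// ler_pM2r// => /andP[ds sc]; split.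
  - by rewrite (le_trans B1)// ler0_norm; lra.
  - by apply: le_trans B2; lra.
  - apply: le_trans hn; have := ln_norm1B_ge_out _ hn2 (ltW ds).
    have : 0 <= ln (1 + d) by rewrite ln_ge0//; lra.
    have := ler0n R (2 ^ n); set N : R := _%:R; nra.
have g4 : (\int[lebesgue2 R]_(z in annulus x `](c' * X)%R, (c * X)%R])
    (max_radius c M z `^ (- alpha))%:E <=
    (F * (1 + (alpha * B) ^+ 2 + alpha * (eps - ln c')) *
     (pi * ((c * X) ^+ 2 - (c' * X) ^+ 2)))%:E)%E.
  rewrite EFinM -lebesgue2_annulus; last 2 first.
  - by rewrite mulr_ge0 ?(ltW x0)//; lra.
  - by rewrite ler_pM2r// ltW.
  apply: (integral_annulus_powRN_le (n := n)) => //; first exact: ltW.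
  move=> s s0; rewrite in_itv /= ltr_pM2r// ler_pM2r// => /andP[ds sc]; split.
  - by rewrite (le_trans B1)// ler0_norm; lra.
  - by apply: le_trans B2; lra.
  - have c'0 : 0 < c' by lra.
    have hc' : 2 <= c' ^+ (2 ^ n).
      by apply: (le_trans hn2); rewrite lerXn2r ?nnegrE//; lra.
    have := ln_norm1B_ge_out c'0 hc' (ltW ds); lra.
apply: (le_trans (leeD (leeD (leeD g1 (g2 _ _ _)) g3) g4)).
- by rewrite mulr_ge0 ?(ltW x0)//; lra.
- by rewrite ler_pM2r//; lra.
- by rewrite ler_pM2r//; lra.
rewrite -!EFinD lee_fin -/F -/X.
have := annuli_budget p0 a0 t0 d0 e0 c'1 c'c kE hW hd he aBe.
have FX : 0 <= F * X ^+ 2 by rewrite mulr_ge0 ?sqr_ge0.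
move=> /(ler_wpM2l FX); set ta := 4 * alpha / tau; lra.
Qed.

Lemma lambda_supermedian_powRN (R : realType) (c M : R) : 1 < c -> 0 < M ->
  exists2 alpha0 : R, 0 < alpha0 & forall alpha : R, 0 < alpha <= alpha0 ->
    lambda_supermedian (max_radius c M) (fun x => max_radius c M x `^ (- alpha)).
Proof.
move=> c1 M0.
have c0 : 0 < c by lra.
have p0 := @pi_gt0 R.
(* any value strictly between 1 and [c] makes the gain [k] positive *)
pose c' := (1 + c) / 2.
have c'1 : 1 < c' by rewrite /c'; lra.
have c'c : c' < c by rewrite /c'; lra.
have l0 : 0 < ln c' by exact: ln_gt0.
pose k : R := pi * ln c' * (c ^+ 2 - c' ^+ 2).
have k0 : 0 < k.
  have c2 : 0 < c ^+ 2 - c' ^+ 2 by nra.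
  exact: mulr_gt0 (mulr_gt0 p0 l0) c2.
pose W := 8 * (1 + c) * (2 + c).
have W0 : 0 < W by rewrite /W !mulr_gt0//; lra.
pose tau := k / (16 * W).
have t0 : 0 < tau by rewrite divr_gt0// mulr_gt0.
have hW : 16 * W * tau <= k by rewrite mulrC divfK// gt_eqF// mulr_gt0.
pose d := Num.min (2^-1) (Num.min (c' - 1) (k * tau / (64 * pi))).
have p64 : 0 < 64 * pi :> R by rewrite mulr_gt0.
have d0 : 0 < d.
  rewrite /d 2!lt_min invr_gt0 ltr0n subr_gt0 c'1 /=.
  exact: divr_gt0 (mulr_gt0 k0 t0) p64.
have d1 : d <= 2^-1 by rewrite ge_min lexx.
have dc' : 1 + d <= c'.
  have : d <= c' - 1 by rewrite !ge_min lexx orbT.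
  lra.
have hd : 64 * pi * d <= k * tau.
  have : d <= k * tau / (64 * pi) by rewrite !ge_min lexx !orbT.
  by rewrite (ler_pdivlMr _ _ p64) mulrC.
pose eps := k / (4 * pi * c ^+ 2).
have p4 : 0 < 4 * pi * c ^+ 2 by rewrite mulr_gt0 ?exprn_gt0 ?mulr_gt0.
have e0 : 0 < eps by exact: divr_gt0.
have he : 4 * pi * c ^+ 2 * eps <= k by rewrite mulrC divfK// gt_eqF.
have [n [hn hn2]] : exists n : nat, ln 2 <= (2 ^ n)%:R * eps /\
    2 <= (1 + d) ^+ (2 ^ n).
  have [|n [h1 h2]] := @exists_expr2_ge R (1 + d) (Num.max 2 (ln 2 / eps)).
    by lra.
  exists n; split; last by apply: le_trans h2; rewrite le_max lexx.
  by rewrite -ler_pdivrMr//; apply: le_trans h1; rewrite le_max lexx orbT.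
have [B [B0 B1 B2]] : exists B : R,
    [/\ 0 < B, expR (- B) <= d & 1 + c <= expR B].
  by apply: exists_expR_bounds => //; lra.
exists (Num.min (8^-1) (Num.min ((3 * B)^-1) (eps / B ^+ 2))).
  rewrite 2!lt_min !invr_gt0 ltr0n mulr_gt0//=.
  by rewrite divr_gt0// exprn_gt0.
move=> alpha /andP[a0]; rewrite !le_min => /and3P[a8 aB ae] x.
have aB' : alpha * B <= 3^-1.
  by move: aB; rewrite -[leRHS]div1r ler_pdivlMr ?mulr_gt0//; lra.
have aB2 : alpha * B ^+ 2 <= eps by rewrite -ler_pdivlMr// exprn_gt0.
have mf := measurable_powR_max_radius c M (- alpha).
have f0 z : 0 <= max_radius c M z `^ (- alpha) by exact: powR_ge0.
have r0 := max_radius_gt0 c x M0.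
have [cx|cx] := leP (c * enorm x) M.
  have rx : max_radius c M x = M by exact/max_idPr.
  apply: (disk_avg_le r0).
  rewrite [leRHS]EFinM -(lebesgue2_disk (ltW r0)).
  apply: (@integral_annulus_le _ 1 0) => // y _.
  rewrite big_nat1 mul1r rx.
  by apply: ger_powRN => //; [exact: le_max_radius|exact: ltW].
exact: (@disk_avg_powRN_le R n c M c' d eps tau k B alpha x).
Qed.

Unset Implicit Arguments.

Theorem proposition1p3 (R : realType) (c M : R) (hc : 1 < c) (hM : 0 < M)
    (r : R * R -> R) (hr : forall x : R * R, r x = Num.max (c * enorm x) M) :
  exists2 alpha0 : R, 0 < alpha0 &
    forall alpha : R, 0 < alpha <= alpha0 ->
      sigma_supermedian r (fun x => r x `^ (- alpha)) /\
      lambda_supermedian r (fun x => r x `^ (- alpha)).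
Proof.
have -> : r = max_radius c M by apply/funext => x; exact: hr.
have [a1 a10 h1] := sigma_supermedian_powRN hc hM.
have [a2 a20 h2] := lambda_supermedian_powRN hc hM.
exists (Num.min a1 a2); first by rewrite lt_min a10.
move=> alpha /andP[al0]; rewrite le_min => /andP[al1 al2].
by split; [apply: h1|apply: h2]; rewrite al0.
Qed.
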